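(* No algorithm in class $B_1$ for two-dimensional online hypercube (square) packing can achieve a competitive ratio of less than $2.0043$.
   Context: Online square packing: items are axis-parallel squares with side length in $(0,1]$ arriving online; each must be irrevocably placed, non-overlapping and without rotation, into a unit square bin upon arrival; the goal is to minimize the number of used bins. The competitive ratio is the asymptotic performance ratio $\limsup_{n\to\infty}\sup_\sigma\{\mathcal{A}(\sigma)/OPT(\sigma): OPT(\sigma)=n\}$. Class $B_1$ consists of online algorithms that distinguish (possibly among other types) the disjoint side-length intervals $I_m=(1/3,y]$ for some $y\in(1/3,1/2]$ and $I_\lambda=(0,\lambda]$ for some $\lambda>0$, and satisfy: (1) there is a parameter $\alpha$ such that an $\alpha$-fraction of the items with side length in $I_m$ are packed 3 per bin (''red items'') and the rest are packed 4 per bin (''blue items''); (2) no bin that contains an item with side length in $I_\lambda$ contains an item of side length larger than $1/2$ or an item with side length in $I_m$; (3) items with side length in $I_m$ are packed without regard to their exact size. *)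

(* Defs.v *)
From HB Require Import structures.
From mathcomp Require Import all_boot all_order all_algebra.
From mathcomp Require Import all_classical all_reals all_analysis.

Set Implicit Arguments.
Unset Strict Implicit.
Unset Printing Implicit Defensive.

Import Order.TTheory GRing.Theory Num.Theory.

Local Open Scope classical_set_scope.
Local Open Scope ring_scope.

Section SquarePacking.
Variable R : realType.

(* An input is the sequence of the side lengths of the items, in order of
   arrival. *)
Definition is_input (s : seq R) : Prop := all (fun x => 0 < x <= 1) s.

(* Bins are copies of [0, 1]^2 labelled by natural numbers; [xpos] and [ypos]
   are the coordinates of the lower left corner of the item. *)
Record placement := Placement { bin : nat; xpos : R; ypos : R }.

Definition in_unit_square (x : R) (p : placement) : Prop :=
  [/\ 0 <= xpos p, xpos p + x <= 1, 0 <= ypos p & ypos p + x <= 1].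

Definition open_square (x : R) (p : placement) : set (R * R) :=
  [set z | xpos p < z.1 < xpos p + x /\ ypos p < z.2 < ypos p + x].

(* In a packing of [s], item number [i] is placed at [P i]; the values [P i]
   with [size s <= i] are irrelevant. *)
Definition feasible (s : seq R) (P : nat -> placement) : Prop :=
  (forall i, (i < size s)%N -> in_unit_square s`_i (P i)) /\
  (forall i j, (i < size s)%N -> (j < size s)%N -> i <> j ->
     bin (P i) = bin (P j) ->
     open_square s`_i (P i) `&` open_square s`_j (P j) = set0).

Definition bins_used (s : seq R) (P : nat -> placement) : nat :=
  size (undup [seq bin (P i) | i <- iota 0 (size s)]).

Definition is_OPT (s : seq R) (n : nat) : Prop :=
  (exists P, feasible s P /\ bins_used s P = n) /\
  (forall P, feasible s P -> (n <= bins_used s P)%N).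

(* [A h x] is the placement of an item of side length [x] arriving after the
   items of [h]. *)
Definition online_packing (A : seq R -> R -> placement) (s : seq R) (i : nat) :
  placement := A (take i s) s`_i.

Record online_algorithm := OnlineAlgorithm {
  place :> seq R -> R -> placement;
  place_feasible : forall s, is_input s -> feasible s (online_packing place s)
}.

Definition cost (A : online_algorithm) (s : seq R) : nat :=
  bins_used s (online_packing A s).

Definition competitive_ratio (A : online_algorithm) : \bar R :=
  limn_esup (fun n : nat =>
    ereal_sup [set ((cost A s)%:R / n%:R)%:E
              | s in [set s | is_input s /\ is_OPT s n]]).

Section ClassB1.
Variables (A : online_algorithm) (Im Il : interval R).

Definition nb_items_in (s : seq R) : nat := count (fun x => x \in Im) s.

Definition nb_items_in_bin (s : seq R) (b : nat) : nat :=
  count (fun i => (s`_i \in Im) && (bin (online_packing A s i) == b))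
        (iota 0 (size s)).

(* The number of items with side length in [Im] that lie in a bin containing
   exactly [k] items with side length in [Im]. *)
Definition nb_packed_per_bin (k : nat) (s : seq R) : nat :=
  count (fun i => (s`_i \in Im) &&
                  (nb_items_in_bin s (bin (online_packing A s i)) == k))
        (iota 0 (size s)).

(* The fractions alpha and 1 - alpha cannot be exact for every number of items
   (rounding, bins that are still being filled): they are attained up to o(N),
   N being the number of items with side length in [Im]. *)
Definition red_blue_rule (alpha : R) : Prop :=
  forall e : R, 0 < e -> exists N0 : nat, forall s : seq R,
    is_input s -> (N0 <= nb_items_in s)%N ->
    let N : R := (nb_items_in s)%:R in
    `|(nb_packed_per_bin 3 s)%:R - alpha * N| <= e * N /\
    `|(nb_packed_per_bin 4 s)%:R - (1 - alpha) * N| <= e * N.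

Definition separation_rule : Prop :=
  forall (s : seq R) (i j : nat), is_input s ->
    (i < size s)%N -> (j < size s)%N ->
    bin (online_packing A s i) = bin (online_packing A s j) ->
    s`_i \in Il -> ~ (1 / 2 < s`_j \/ s`_j \in Im).

Definition same_up_to_sizes (s t : seq R) : Prop :=
  size s = size t /\
  forall i, (i < size s)%N -> s`_i = t`_i \/ (s`_i \in Im /\ t`_i \in Im).

(* The bin of an item with side length in [Im] may depend on the previous items
   and on the bins they were put into, but not on the exact size of any item
   with side length in [Im]. *)
Definition size_oblivious_rule : Prop :=
  forall (s t : seq R) (x x' : R), is_input s -> is_input t ->
    same_up_to_sizes s t ->
    (forall i, (i < size s)%N ->
       bin (online_packing A s i) = bin (online_packing A t i)) ->
    x \in Im -> x' \in Im -> bin (A s x) = bin (A t x').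

End ClassB1.

Definition class_B1 (A : online_algorithm) : Prop :=
  exists y lambda alpha : R,
    let Im := `]1 / 3, y] in
    let Il := `]0, lambda] in
    [/\ 1 / 3 < y <= 1 / 2, 0 < lambda, [set` Im] `&` [set` Il] = set0 &
        0 <= alpha <= 1] /\
    [/\ red_blue_rule A Im alpha,
        separation_rule A Im Il &
        size_oblivious_rule A Im].

End SquarePacking.

(* Main.v *)
Require Import Defs.
From mathcomp Require Import all_boot all_order all_algebra.
From mathcomp Require Import all_classical all_reals all_analysis.
From mathcomp Require Import zify ring lra.

(* The input consists of medium items (side in Im), large items (side > 1/2) and
   sand (side in Il). The algorithm puts sand into bins of its own, and a bin
   with 4 medium items has no room for a large one.

   If alpha <= 0.2164, take N medium items of side just above 1/3, N/3 large
   items of side just above 1/2, and sand filling the gaps of bins that hold one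
   large and three medium items. The algorithm needs about N/3 bins for the large
   items, (1 - alpha) N/4 for the blue items, and the area of the sand.

   If alpha >= 0.2164, choose the sizes of the medium items after seeing their
   bins, which do not depend on these sizes: one item of each red bin has side y,
   all others have side just above 1/3. Large items of side just above 1 - y then
   fit into no red bin, while three of the smaller medium items still fit next to
   one of them. Filling with sand the bins of one large and three small medium
   items, and the bins of four items of side y, gives an optimal packing into
   about (N - R)/3 + R/4 bins, where R = alpha N/3 is the number of red bins.
   The two bounds meet near alpha = 0.2165 when y tends to 1/3. *)

Local Open Scope ring_scope.

Section Packing.
Set Implicit Arguments.
Unset Strict Implicit.
Unset Printing Implicit Defensive.
Import Order.TTheory GRing.Theory Num.Theory.
Local Open Scope classical_set_scope.

Variable R : realType.
Implicit Types (s t u : seq R) (P : nat -> placement R).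

(** * How many items fit into one bin *)

Lemma exists_grid_point (k : nat) (x z : R) :
  0 <= x -> x + z <= 1 -> 1 / k.+1%:R < z ->
  exists i : 'I_k, x < i.+1%:R / k.+1%:R < x + z.
Proof.
move=> x0 xz1 kz.
have k0 : (0 : R) < k.+1%:R by rewrite ltr0n.
have xk0 : 0 <= x * k.+1%:R by rewrite mulr_ge0 // ltW.
have [n nP] : exists n : nat, n%:R <= x * k.+1%:R < n.+1%:R.
  by exists (Num.truncn (x * k.+1%:R)); apply: Num.Theory.truncn_itv.
have /andP[n1 n2] := nP.
have e1 : x < n.+1%:R / k.+1%:R by rewrite ltr_pdivlMr.
have e2 : n.+1%:R / k.+1%:R < x + z.
  apply: (@le_lt_trans _ _ (x + 1 / k.+1%:R)); last by rewrite ltrD2l.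
  by rewrite -natr1 mulrDl lerD2r ler_pdivrMr.
have nk : (n < k)%N.
  have : n.+1%:R / k.+1%:R < (1 : R) by apply: lt_le_trans e2 _.
  by rewrite ltr_pdivrMr // mul1r ltr_nat ltnS.
by exists (Ordinal nk); rewrite /= e1 e2.
Qed.

(* Each square of side > 1 / (k + 1) contains one of the k ^ 2 points with
   coordinates in {1 / (k + 1), ..., k / (k + 1)}. *)
Lemma items_per_bin_le (k : nat) s P (J : seq nat) (b : nat) :
  feasible s P -> uniq J ->
  (forall i, i \in J ->
     [/\ (i < size s)%N, bin (P i) = b & 1 / k.+1%:R < s`_i]) ->
  (size J <= k * k)%N.
Proof.
move=> [sP dP] uJ JP.
have gP (i : nat) : exists g : nat * nat, i \in J ->
    [/\ (g.1 < k)%N, (g.2 < k)%N &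
    open_square s`_i (P i) (g.1.+1%:R / k.+1%:R, g.2.+1%:R / k.+1%:R)].
  case: (boolP (i \in J)) => [iJ|_]; last by exists (0, 0)%N.
  have [iz _ ki] := JP i iJ; have [x0 x1 y0 y1] := sP i iz.
  have [u uP] := exists_grid_point x0 x1 ki.
  have [v vP] := exists_grid_point y0 y1 ki.
  by exists (nat_of_ord u, nat_of_ord v) => _; split => /=.
have [g {}gP] := choice gP.
have -> : (k * k = size [seq (c, d) | c <- iota 0 k, d <- iota 0 k])%N.
  by rewrite size_allpairs size_iota.
rewrite -(size_map g); apply: uniq_leq_size.
  rewrite map_inj_in_uniq // => i j iJ jJ gij.
  apply: contrapT => ij.
  have [iz ib _] := JP i iJ; have [jz jb _] := JP j jJ.
  have [_ _ gi] := gP i iJ; have [_ _ gj] := gP j jJ.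
  rewrite -gij in gj.
  have /seteqP[+ _] := dP i j iz jz ij (etrans ib (esym jb)).
  by move=> /(_ _ (conj gi gj)).
move=> _ /mapP[i iJ ->]; have [u v _] := gP i iJ.
by apply/allpairsP; exists (g i); rewrite !mem_iota; case: (g i) u v.
Qed.

(** In each coordinate the two projections are subintervals of [0, 1] of total length above 1, so
    they share an interior point; the two points together give a point of both open squares. *)
Lemma two_items_in_bin_le1 s P i j :
  feasible s P -> (i < size s)%N -> (j < size s)%N -> i <> j ->
  0 < s`_i -> 0 < s`_j ->
  bin (P i) = bin (P j) -> s`_i + s`_j <= 1.
Proof.
move=> [sP dP] iz jz ij i0 j0 bij; rewrite leNgt; apply/negP => ij1.
have [x0 x1 y0 y1] := sP i iz; have [x0' x1' y0' y1'] := sP j jz.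
have overlap (x x' a a' : R) : 0 <= x -> x + a <= 1 -> 0 <= x' -> x' + a' <= 1 ->
    0 < a -> 0 < a' -> 1 < a + a' -> exists z, x < z < x + a /\ x' < z < x' + a'.
  move=> *; case: (leP x x') => xx; case: (leP (x + a) (x' + a')) => aa.
  - by exists ((x' + (x + a)) / 2); lra.
  - by exists ((x' + (x' + a')) / 2); lra.
  - by exists ((x + (x + a)) / 2); lra.
  - by exists ((x + (x' + a')) / 2); lra.
have [u [u1 u2]] := overlap _ _ _ _ x0 x1 x0' x1' i0 j0 ij1.
have [v [v1 v2]] := overlap _ _ _ _ y0 y1 y0' y1' i0 j0 ij1.
have /seteqP[+ _] := dP i j iz jz ij bij.
by move=> /(_ (u, v)); apply.
Qed.

(** * Offline packings *)

(** Bounding the labels, rather than counting the used bins, makes concatenation a mere shift of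
    labels. *)
Definition packable s (n : nat) : Prop :=
  exists P, feasible s P /\ forall i, (i < size s)%N -> (bin (P i) < n)%N.

Lemma packable_nil n : packable [::] n.
Proof. by exists (fun=> Placement 0 0 0); split. Qed.

(** Serves to pad an input until its bins are full and to drop the padding afterwards. *)
Lemma packable_catl s t n : packable (s ++ t) n -> packable s n.
Proof.
have sz i : (i < size s -> i < size (s ++ t))%N.
  by rewrite size_cat => /ltn_addr->.
have E i : (i < size s)%N -> (s ++ t)`_i = s`_i by rewrite nth_cat => ->.
move=> [P [[sP dP] bP]]; exists P; split; last by move=> i /sz/bP.
split=> [i iz|i j iz jz ij b]; first by rewrite -E //; apply/sP/sz.
by rewrite -(E i) // -(E j) //; apply: dP => //; apply: sz.
Qed.

Lemma packable_perm s t n : perm_eq s t -> packable t n -> packable s n.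
Proof.
move=> /(perm_iotaP 0)[I Ip ->] [P [[sP dP] bP]].
have Iu : uniq I by rewrite (perm_uniq Ip) iota_uniq.
have It i : (i < size I)%N -> (nth 0 I i < size t)%N.
  by move=> iI; have := mem_nth 0%N iI; rewrite (perm_mem Ip) mem_iota.
exists (P \o nth 0%N I); rewrite /feasible size_map.
split; last by move=> i iI; apply/bP/It.
split=> [i iI|i j iI jI ij b].
  by rewrite (nth_map 0%N) //; apply/sP/It.
rewrite !(nth_map 0%N) //; apply: dP => //; [exact: It|exact: It|].
by move=> /eqP; rewrite nth_uniq // => /eqP.
Qed.

Lemma packable_cat s t m n :
  packable s m -> packable t n -> packable (s ++ t) (m + n).
Proof.
move=> [P [[sP dP] bP]] [Q [[sQ dQ] bQ]].
pose F i := if (i < size s)%N then P i else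
  let q := Q (i - size s)%N in Placement (m + bin q) (xpos q) (ypos q).
have sz i : (i < size (s ++ t) -> ~~ (i < size s) -> i - size s < size t)%N.
  by rewrite size_cat; lia.
exists F; split=> [|i iz]; last first.
  rewrite /F; case: ifPn => [/bP /ltn_addr-> //|iNs] /=.
  by rewrite ltn_add2l; apply/bQ/sz.
split=> [i iz|i j iz jz ij].
  rewrite /F nth_cat; case: ifPn => [/sP //|iNs].
  by have := sQ _ (sz i iz iNs).
rewrite /F !nth_cat.
case: ifPn => [is_|iNs]; case: ifPn => [js|jNs] /=.
- exact: dP.
- by move=> b; have := bP _ is_; rewrite b ltnNge leq_addr.
- by move=> b; have := bP _ js; rewrite -b ltnNge leq_addr.
- move=> /addnI; apply: dQ; [exact: sz|exact: sz|].
  by move: iNs jNs ij; rewrite -!leqNgt; lia.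
Qed.

Lemma packable_flatten_nseq s n :
  packable s 1 -> packable (flatten (nseq n s)) n.
Proof.
move=> s1; elim: n => [|n IH] /=; first exact: packable_nil.
by rewrite -add1n; apply: packable_cat.
Qed.

Lemma packable_is_OPT s n : packable s n -> exists2 m, is_OPT s m & (m <= n)%N.
Proof.
move=> [P [fP bP]].
have bn : (bins_used s P <= n)%N.
  rewrite -(size_iota 0 n); apply: uniq_leq_size; first exact: undup_uniq.
  move=> b; rewrite mem_undup => /mapP[i]; rewrite !mem_iota /= => iz ->.
  exact: bP.
have ex : exists m, `[< exists Q, feasible s Q /\ bins_used s Q = m >].
  by exists (bins_used s P); apply/asboolP; exists P.
case: (ex_minnP ex) => m /asboolP mP mmin.
exists m; last by apply: leq_trans bn; apply: mmin; apply/asboolP; exists P.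
by split=> // Q fQ; apply: mmin; apply/asboolP; exists Q.
Qed.

(** * Packings aligned to a grid *)

(* (x, y, c) stands for the square of c * c cells with lower left cell (x, y)
   in the division of the unit square into K * K cells. *)
Definition grid_disjoint (g h : nat * nat * nat) : bool :=
  [|| g.1.1 + g.2 <= h.1.1, h.1.1 + h.2 <= g.1.1,
      g.1.2 + g.2 <= h.1.2 | h.1.2 + h.2 <= g.1.2]%N.

Definition grid_covers (g : nat * nat * nat) (c : nat * nat) : bool :=
  (g.1.1 <= c.1 < g.1.1 + g.2)%N && (g.1.2 <= c.2 < g.1.2 + g.2)%N.

(** An item sits in the lower left corner of its block of cells and may be smaller than the block.
    Disjoint blocks are separated along one axis. *)
Lemma packable_grid (K : nat) (L : seq (R * (nat * nat * nat))) :
  (0 < K)%N ->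
  (forall e, e \in L -> [/\ e.1 <= e.2.2%:R / K%:R,
     (e.2.1.1 + e.2.2 <= K)%N & (e.2.1.2 + e.2.2 <= K)%N]) ->
  pairwise (fun e f => grid_disjoint e.2 f.2) L ->
  packable [seq e.1 | e <- L] 1.
Proof.
move=> K0 LK; set e0 : R * (nat * nat * nat) := (0, (0, 0, 0)%N).
move/(pairwiseP e0) => Ld.
have Kr : (0 : R) < K%:R by rewrite ltr0n.
pose x i : R := (nth e0 L i).2.1.1%:R / K%:R.
pose y i : R := (nth e0 L i).2.1.2%:R / K%:R.
exists (fun i => Placement 0 (x i) (y i)).
rewrite /feasible size_map; split=> //.
have le_grid (a b : nat) z : z <= b%:R / K%:R ->
    a%:R / K%:R + z <= (a + b)%:R / K%:R :> R.
  by move=> zb; rewrite natrD mulrDl lerD2l.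
split=> [i iL|].
  have [e1 e2 e3] := LK _ (mem_nth e0 iL).
  have le1 (a : nat) : (a <= K)%N -> a%:R / K%:R <= 1 :> R.
    by move=> aK; rewrite ler_pdivrMr // mul1r ler_nat.
  rewrite (nth_map e0) //; split; rewrite /= /x /y ?divr_ge0 //.
  - by apply: le_trans (le_grid _ _ _ e1) (le1 _ e2).
  - by apply: le_trans (le_grid _ _ _ e1) (le1 _ e3).
have sep i j : (i < size L)%N -> (j < size L)%N ->
    grid_disjoint (nth e0 L i).2 (nth e0 L j).2 ->
    open_square (nth e0 L i).1 (Placement 0 (x i) (y i)) `&`
    open_square (nth e0 L j).1 (Placement 0 (x j) (y j)) = set0.
  move=> iL jL D; apply/seteqP; split=> // -[u v] [[/= ui vi] [/= uj vj]]; exfalso.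
  have [i1 _ _] := LK _ (mem_nth e0 iL).
  have [j1 _ _] := LK _ (mem_nth e0 jL).
  have := le_grid (nth e0 L i).2.1.1 _ _ i1.
  have := le_grid (nth e0 L i).2.1.2 _ _ i1.
  have := le_grid (nth e0 L j).2.1.1 _ _ j1.
  have := le_grid (nth e0 L j).2.1.2 _ _ j1.
  have mon (a b : nat) : (a <= b)%N -> a%:R / K%:R <= b%:R / K%:R :> R.
    by move=> ab; rewrite ler_pM2r ?invr_gt0 // ler_nat.
  rewrite -/(x i) -/(y i) -/(x j) -/(y j).
  by case/or4P: D => /mon; rewrite -/(x i) -/(y i) -/(x j) -/(y j); lra.
move=> i j iL jL ij _; rewrite !(nth_map e0) //.
have [lt_ij|lt_ji|/ij//] := ltngtP i j; first by apply: sep => //; apply: Ld.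
by rewrite setIC; apply: sep => //; apply: Ld.
Qed.

Lemma count_grid_covers (g : nat * nat * nat) (C : seq (nat * nat)) :
  uniq C -> (count (grid_covers g) C <= g.2 * g.2)%N.
Proof.
move=> uC; have -> : (g.2 * g.2)%N =
    size [seq (c, d) | c <- iota g.1.1 g.2, d <- iota g.1.2 g.2].
  by rewrite size_allpairs !size_iota.
rewrite -size_filter; apply: uniq_leq_size; first exact: filter_uniq.
move=> [c d]; rewrite mem_filter => /andP[/andP[cg dg] _].
by apply/allpairsP; exists (c, d); rewrite !mem_iota.
Qed.

(** Every cell outside the blocks can take one sand item of side 1 / K. *)
Lemma packable_grid_sand (K : nat) (L : seq (R * (nat * nat * nat))) :
  (0 < K)%N ->
  (forall e, e \in L -> [/\ e.1 <= e.2.2%:R / K%:R,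
     (e.2.1.1 + e.2.2 <= K)%N & (e.2.1.2 + e.2.2 <= K)%N]) ->
  pairwise (fun e f => grid_disjoint e.2 f.2) L ->
  packable ([seq e.1 | e <- L] ++
            nseq (K * K - \sum_(e <- L) e.2.2 * e.2.2) (1 / K%:R)) 1.
Proof.
move=> K0 LK Ld.
pose C := [seq (c, d) | c <- iota 0 K, d <- iota 0 K].
have uC : uniq C.
  by apply: allpairs_uniq => [||[? ?] [? ?] _ _ [-> ->]]; rewrite ?iota_uniq.
pose covered (c : nat * nat) := has (fun e => grid_covers e.2 c) L.
pose F := [seq c <- C | ~~ covered c].
(* Union bound: a block of side [c] covers at most [c * c] cells. *)
have szF : (K * K - \sum_(e <- L) e.2.2 * e.2.2 <= size F)%N.
  have -> : (K * K)%N = size C by rewrite size_allpairs size_iota.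
  rewrite size_filter -(count_predC covered C) leq_subLR leq_add2r.
  rewrite /covered; elim: (L) => [|e L' IH] /=.
    by rewrite count_pred0 big_nil.
  rewrite big_cons; apply: leq_trans (leq_add (count_grid_covers e.2 uC) IH).
  by rewrite -count_predUI leq_addr.
pose G := L ++ [seq (1 / K%:R : R, (c, 1%N)) | c <- F].
have GP : packable [seq e.1 | e <- G] 1.
  apply: (packable_grid (K := K)) => //.
    move=> e; rewrite mem_cat => /orP[/LK //|/mapP[[c d]]].
    rewrite mem_filter => /andP[_ /allpairsP[[c' d']]] /=.
    by rewrite !mem_iota => -[c'K d'K [-> ->]] -> /=; split=> //; lia.
  rewrite pairwise_cat Ld /= andbC; apply/andP; split.
    rewrite pairwise_map; have := filter_uniq (fun c => ~~ covered c) uC.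
    rewrite uniq_pairwise; apply: sub_pairwise => -[c d] [c' d'] /=.
    by rewrite /grid_disjoint xpair_eqE /=; lia.
  apply/allrelP => -[z [[a b] w]] f eL /mapP[[c d]].
  rewrite mem_filter => /andP[+ _] -> {f}.
  by move=> /hasPn/(_ _ eL); rewrite /grid_covers /grid_disjoint /=; lia.
apply: (packable_catl (t := nseq (size F -
  (K * K - \sum_(e <- L) e.2.2 * e.2.2)) (1 / K%:R))).
rewrite -catA -nseqD subnKC //.
suff -> : nseq (size F) (1 / K%:R : R) =
    [seq e.1 | e <- [seq (1 / K%:R : R, (c, 1%N)) | c <- F]].
  by rewrite -map_cat.
by rewrite -map_comp; elim: (F) => //= c F' ->.
Qed.

(** The large square takes the lower left corner of the bin and the three medium ones the other
    corners. *)
Lemma packable_large_and_three (K p q : nat) :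
  (0 < p)%N -> (p + q <= K)%N -> (2 * p <= K)%N ->
  packable ([:: q%:R / K%:R : R; p%:R / K%:R; p%:R / K%:R; p%:R / K%:R] ++
            nseq (K * K - (q * q + 3 * (p * p))) (1 / K%:R)) 1.
Proof.
move=> p0 pqK pK.
pose L : seq (R * (nat * nat * nat)) :=
  [:: (q%:R / K%:R, (0, 0, q)%N); (p%:R / K%:R, (K - p, 0, p)%N);
      (p%:R / K%:R, (0, K - p, p)%N); (p%:R / K%:R, (K - p, K - p, p)%N)].
have -> : (q * q + 3 * (p * p) = \sum_(e <- L) e.2.2 * e.2.2)%N.
  by rewrite !big_cons big_nil /=; lia.
apply: (packable_grid_sand (L := L)); first by lia.
  by move=> e; rewrite !inE => /or4P[] /eqP -> /=; split=> //; lia.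
by rewrite /= /grid_disjoint /=; lia.
Qed.

(** Each side [y] is rounded up to a block of [r] cells; sand fills only the cells outside the
    blocks. *)
Lemma packable_four (K r : nat) (y : R) :
  (0 < K)%N -> (2 * r <= K)%N -> y <= r%:R / K%:R ->
  packable ([:: y; y; y; y] ++ nseq (K * K - 4 * (r * r)) (1 / K%:R)) 1.
Proof.
move=> K0 rK yr.
pose L : seq (R * (nat * nat * nat)) :=
  [:: (y, (0, 0, r)%N); (y, (r, 0, r)%N); (y, (0, r, r)%N); (y, (r, r, r)%N)].
have -> : (4 * (r * r) = \sum_(e <- L) e.2.2 * e.2.2)%N.
  by rewrite !big_cons big_nil /=; lia.
apply: (packable_grid_sand (L := L)) => //.
  by move=> e; rewrite !inE => /or4P[] /eqP -> /=; split=> //; lia.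
by rewrite /= /grid_disjoint /=; lia.
Qed.

(** * Counting the bins of a set of items *)

Lemma sum_const_seq (X : seq nat) (c : nat) : (\sum_(b <- X) c = size X * c)%N.
Proof. by rewrite big_const_seq count_predT iter_addn_0 mulnC. Qed.

Lemma size_sum_count_mem (X : seq nat) :
  (size X = \sum_(b <- undup X) count_mem b X)%N.
Proof.
rewrite -sum1_size -(big_undup_iterop_count addn X xpredT (fun=> 1%N)) /=.
apply: eq_bigr => b _; elim: (count_mem b X) => // n; case: n => //= n.
by rewrite -/(iterop n.+1 addn 1 0)%N => ->.
Qed.

(** Applied with [k = 1], it puts large items into distinct bins; with [k = K], it is the area bound
    for sand, whose side 1 / K exceeds 1 / (K + 1). *)
Lemma bins_of_items_ge (k : nat) s P (J : seq nat) :
  feasible s P -> uniq J ->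
  (forall i, i \in J -> (i < size s)%N /\ 1 / k.+1%:R < s`_i) ->
  (size J <= k * k * size (undup [seq bin (P i) | i <- J]))%N.
Proof.
move=> fP uJ JP; set X := map _ J; rewrite -(size_map (fun i => bin (P i)) J) -/X.
rewrite size_sum_count_mem mulnC -sum_const_seq; apply: leq_sum => b _.
rewrite count_map -size_filter; apply: (items_per_bin_le (b := b) fP).
  exact: filter_uniq.
by move=> i; rewrite mem_filter => /andP[/eqP <- /JP[]].
Qed.

(** * The bins of an online algorithm *)

Section Algorithm.
Variables (A : online_algorithm R) (Im Il : interval R).

Local Notation pos := (online_packing A).

(** The red bins for [k = 3] and the blue bins for [k = 4]. *)
Definition bins_with (k : nat) s : seq nat :=
  undup [seq bin (pos s i) | i <- iota 0 (size s) &
         (s`_i \in Im) && (nb_items_in_bin A Im s (bin (pos s i)) == k)].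

Lemma mem_bins_with k s b : b \in bins_with k s ->
  exists i, [/\ (i < size s)%N, s`_i \in Im, b = bin (pos s i) &
                nb_items_in_bin A Im s b = k].
Proof.
rewrite mem_undup => /mapP[i]; rewrite mem_filter mem_iota /=.
by move=> /andP[/andP[iI /eqP ik] iz] ->; exists i.
Qed.

(** Double counting; it turns the fractions of items in [red_blue_rule] into numbers of bins. *)
Lemma nb_packed_per_binE k s :
  nb_packed_per_bin A Im k s = (k * size (bins_with k s))%N.
Proof.
rewrite /nb_packed_per_bin -size_filter -(size_map (fun i => bin (pos s i))).
rewrite size_sum_count_mem mulnC -sum_const_seq.
apply: eq_big_seq => b /mem_bins_with[_ [_ _ _ nb]]; rewrite -[RHS]nb.
rewrite count_map count_filter; apply: eq_in_count => i _ /=.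
case: eqP => [->|_]; last by rewrite andbF.
by rewrite nb eqxx andbT.
Qed.

Lemma online_packing_catl s u i :
  (i < size s)%N -> pos (s ++ u) i = pos s i.
Proof.
by move=> iz; rewrite /online_packing nth_cat iz takel_cat // ltnW.
Qed.

Lemma nb_items_in_bin_catl s u b : {in u, forall x, x \notin Im} ->
  nb_items_in_bin A Im (s ++ u) b = nb_items_in_bin A Im s b.
Proof.
move=> uI; rewrite /nb_items_in_bin size_cat iotaD count_cat.
rewrite [X in (_ + X)%N](_ : _ = 0%N) ?addn0.
  apply: eq_in_count => i; rewrite mem_iota /= => iz.
  by rewrite online_packing_catl // nth_cat iz.
rewrite (@eq_in_count _ _ pred0) ?count_pred0 // => i.
rewrite mem_iota add0n => /andP[si iz] /=.
apply/negbTE; rewrite negb_and nth_cat ltnNge si /= uI //.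
by rewrite mem_nth // ltn_subLR.
Qed.

(** Placements are irrevocable, so large items and sand arriving later leave the red and blue bins
    as they are. *)
Lemma bins_with_catl k s u : {in u, forall x, x \notin Im} ->
  bins_with k (s ++ u) = bins_with k s.
Proof.
move=> uI; rewrite /bins_with size_cat iotaD filter_cat map_cat.
rewrite [X in _ ++ X](_ : _ = [::]) ?cats0.
  rewrite (eq_in_filter (a2 := fun i => (s`_i \in Im) &&
    (nb_items_in_bin A Im s (bin (pos s i)) == k))) => [|i].
    congr undup; apply/eq_in_map => i.
    rewrite mem_filter mem_iota => /andP[_ /= iz].
    by rewrite online_packing_catl.
  rewrite mem_iota /= => iz.
  by rewrite nb_items_in_bin_catl // online_packing_catl // nth_cat iz.
rewrite (@eq_in_filter _ _ pred0) ?filter_pred0 // => i.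
rewrite mem_iota add0n => /andP[si iz] /=.
apply/negbTE; rewrite negb_and nth_cat ltnNge si /= uI //.
by rewrite mem_nth // ltn_subLR.
Qed.

(** Strong induction on the index: the rule applies to the prefixes of length [i], whose bins agree
    by the induction hypothesis. *)
Lemma size_oblivious_bins s t : size_oblivious_rule A Im ->
  is_input s -> is_input t -> size s = size t ->
  {in s, forall x, x \in Im} -> {in t, forall x, x \in Im} ->
  forall i, (i < size s)%N -> bin (pos s i) = bin (pos t i).
Proof.
move=> ob si ti st sI tI i; elim/ltn_ind: i => i IH iz.
have itz : (i < size t)%N by rewrite -st.
have take_in (w : seq R) : is_input w -> is_input (take i w).
  by move=> /allP wi; apply/allP => x /mem_take/wi.
apply: (ob _ _ _ _ (take_in _ si) (take_in _ ti)); last 2 first.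
- by apply: sI; rewrite mem_nth.
- by apply: tI; rewrite mem_nth.
- split; first by rewrite !size_take st.
  rewrite size_take iz => j ji; right; rewrite !nth_take //.
  by split; [apply: sI|apply: tI]; rewrite mem_nth // -?st (ltn_trans ji).
- rewrite size_take iz => j ji.
  rewrite /online_packing !take_takel ?(ltnW ji) // !nth_take //.
  by apply: IH => //; apply: ltn_trans iz.
Qed.

(* The bins of the small items, those of the large items and those in [B] are
   pairwise distinct. *)
Lemma cost_ge (K : nat) s (Js Jl B : seq nat) :
  separation_rule A Im Il -> is_input s -> uniq Js -> uniq Jl -> uniq B ->
  (forall i, i \in Js -> [/\ (i < size s)%N, s`_i \in Il & 1 / K.+1%:R < s`_i]) ->
  (forall i, i \in Jl -> (i < size s)%N /\ 1 / 2 < s`_i) ->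
  (forall b, b \in B -> exists i, [/\ (i < size s)%N, s`_i \in Im &
     b = bin (pos s i)]) ->
  (forall j, j \in Jl -> bin (pos s j) \notin B) ->
  (size Js + K * K * (size Jl + size B) <= K * K * cost A s)%N.
Proof.
move=> sep si uJs uJl uB JsP JlP BP JlB; have fP := place_feasible A si.
pose bs := undup [seq bin (pos s i) | i <- Js].
pose bl := undup [seq bin (pos s i) | i <- Jl].
have les : (size Js <= K * K * size bs)%N.
  by apply: (bins_of_items_ge fP uJs) => i /JsP[].
have lel : (size Jl <= size bl)%N.
  have := bins_of_items_ge (k := 1) fP uJl JlP.
  by rewrite !mul1n.
have leb : (size bs + (size bl + size B) <= cost A s)%N.
  rewrite -!size_cat; apply: uniq_leq_size; last first.
    move=> b; rewrite !mem_cat !mem_undup => H; apply/mapP.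
    case/or3P: H => [/mapP[i /JsP[iz _ _] ->]|/mapP[i /JlP[iz _] ->]|/BP[i [iz _ ->]]];
      by exists i; rewrite ?mem_iota.
  rewrite !cat_uniq !undup_uniq uB /= andbT; apply/andP; split; last first.
    apply/hasPn => b bB; rewrite mem_undup; apply/mapP => -[j jl bj].
    by have := JlB j jl; rewrite -bj bB.
  (* The separation rule keeps the sand bins apart from both other groups. *)
  apply/hasPn => b; rewrite mem_cat !mem_undup => H.
  apply/mapP => -[i /JsP[iz iI _] bi].
  case/orP: H => [/mapP[j /JlP[jz j2] bj]|/BP[j [jz jI bj]]].
    by apply: (sep s i j si iz jz _ iI); [rewrite -bi -bj|left].
  by apply: (sep s i j si iz jz _ iI); [rewrite -bi -bj|right].
nia.
Qed.

(** Otherwise the bin would hold five items of side above 1/3, while it has room for at most 2 *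
    2. *)
Lemma large_item_notin_bins_with4 s j : is_input s ->
  {in Im, forall x : R, 1 / 3 < x <= 1 / 2} -> (j < size s)%N -> 1 / 2 < s`_j ->
  bin (pos s j) \notin bins_with 4 s.
Proof.
move=> si ImP jz j2; apply/negP => /mem_bins_with[_ [_ _ _]].
set b := bin _; rewrite /nb_items_in_bin -size_filter.
set J := seq.filter _ _ => J4.
have jJ : j \notin J.
  rewrite mem_filter; apply/negP => /andP[/andP[/ImP/andP[_ jI] _] _].
  by move: (lt_le_trans j2 jI); rewrite ltxx.
have : (size (j :: J) <= 2 * 2)%N.
  apply: (items_per_bin_le (b := b) (place_feasible A si)).
    by rewrite /= jJ filter_uniq // iota_uniq.
  move=> i; rewrite inE => /orP[/eqP ->|]; first by split=> //; lra.
  rewrite mem_filter mem_iota /= => /andP[/andP[/ImP/andP[i3 _] /eqP ib] iz].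
  by split.
by rewrite /= J4.
Qed.

(* The bins are those of the input [nseq N y], by obliviousness. *)
Lemma mark_red_bins (N : nat) (y a : R) :
  size_oblivious_rule A Im -> {in Im, forall x : R, 0 < x <= 1} ->
  y \in Im -> a \in Im -> y != a ->
  exists s, [/\ size s = N, {in s, forall x, x = a \/ x = y},
    size (bins_with 3 s) = count_mem y s &
    forall b, b \in bins_with 3 s ->
      exists i, [/\ (i < size s)%N, s`_i = y & bin (pos s i) = b]].
Proof.
move=> ob Im01 yI aI ya.
pose s0 := nseq N y; pose f i := bin (pos s0 i).
have sz0 : size s0 = N by rewrite size_nseq.
pose B := bins_with 3 s0.
(* [index] selects the first item of each red bin; these items get side [y]. *)
pose M := [seq index b [seq f i | i <- iota 0 N] | b <- B].
pose s := mkseq (fun i => if i \in M then y else a) N.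
have szs : size s = N by rewrite size_mkseq.
have Bf b : b \in B -> b \in [seq f i | i <- iota 0 N].
  move=> /mem_bins_with[i [iN _ -> _]]; apply: map_f.
  by rewrite mem_iota -sz0.
have Mlt b : b \in B -> (index b [seq f i | i <- iota 0 N] < N)%N.
  by move=> /Bf; rewrite -index_mem size_map size_iota.
have fM b : b \in B -> f (index b [seq f i | i <- iota 0 N]) = b.
  move=> bB; have := nth_index 0%N (Bf b bB).
  by rewrite (nth_map 0%N) ?size_iota ?Mlt // nth_iota ?Mlt.
have say : {in s, forall x, x = a \/ x = y}.
  by move=> _ /mapP[i _ ->]; case: ifP; [right|left].
have sI : {in s, forall x, x \in Im} by move=> x /say[->|->].
have s0I : {in s0, forall x, x \in Im} by move=> x /nseqP[->].
have in_s t : {in t, forall x, x \in Im} -> is_input t.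
  by move=> tI; apply/allP => x /tI/Im01.
have fs i : (i < N)%N -> bin (pos s i) = f i.
  by rewrite -szs; apply: size_oblivious_bins => //; rewrite ?szs //; apply: in_s.
have sIn i : (i < N)%N -> s`_i \in Im by move=> iN; rewrite sI // mem_nth // szs.
have s0In i : (i < N)%N -> s0`_i \in Im by move=> iN; rewrite s0I // mem_nth // sz0.
have nbE b : nb_items_in_bin A Im s b = nb_items_in_bin A Im s0 b.
  rewrite /nb_items_in_bin szs sz0; apply: eq_in_count => i.
  rewrite mem_iota /= => iN; by rewrite fs // sIn // s0In.
have BE : bins_with 3 s = B.
  rewrite /B /bins_with szs sz0.
  rewrite (eq_in_filter (a2 := fun i => (s0`_i \in Im) &&
    (nb_items_in_bin A Im s0 (bin (pos s0 i)) == 3))) => [|i].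
    congr undup; apply/eq_in_map => i.
    by rewrite mem_filter mem_iota => /andP[_ /= iN]; rewrite fs.
  rewrite mem_iota /= => iN; by rewrite nbE fs // sIn // s0In.
exists s; split=> //; last first.
  move=> b; rewrite BE => bB; exists (index b [seq f i | i <- iota 0 N]).
  rewrite szs nth_mkseq ?Mlt // fs ?Mlt // fM //; split=> //.
  by rewrite ifT //; apply: map_f.
rewrite BE -(size_map (fun b => index b [seq f i | i <- iota 0 N])) -/M.
rewrite /s /mkseq count_map.
(* Distinct bins have distinct first items, so there are as many items of side [y] as red bins. *)
have uM : uniq M.
  rewrite map_inj_in_uniq ?undup_uniq // => b c bB cB bc.
  by rewrite -(fM b) // bc fM.
rewrite (@eq_count _ _ (fun i => i \in M)); last first.
  by move=> i /=; case: ifP => _; rewrite ?eqxx // eq_sym (negbTE ya).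
rewrite -size_filter; apply/perm_size/uniq_perm => //.
  by rewrite filter_uniq // iota_uniq.
move=> i; rewrite mem_filter mem_iota /=.
by case: (boolP (i \in M)) => // /mapP[b bB ->]; rewrite Mlt.
Qed.

(** [B] consists of red bins that no large item can enter, each holding an item of side above
    [1 - l]. Blue bins are closed to large items anyway, so these bins add to those of the large
    items and of the sand. *)
Lemma input_cost_ge (K L S : nat) s (B : seq nat) (l : R) :
  separation_rule A Im Il -> (0 < K)%N ->
  {in Im, forall x : R, 1 / 3 < x <= 1 / 2} -> 1 / K%:R \in Il ->
  1 / K%:R \notin Im -> 1 / 2 < l <= 1 ->
  {in s, forall x, x \in Im} -> uniq B -> {subset B <= bins_with 3 s} ->
  (forall b, b \in B ->
     exists i, [/\ (i < size s)%N, 1 < s`_i + l & bin (pos s i) = b]) ->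
  (S + K * K * (L + (size B + size (bins_with 4 s))) <=
   K * K * cost A (s ++ nseq L l ++ nseq S (1 / K%:R)))%N.
Proof.
move=> sep K0 ImP dl dm l2 sI uB B3 BP; set w := s ++ _.
have /andP[l_gt l_le] := l2.
have Kr : (0 : R) < K%:R by rewrite ltr0n.
have uI : {in nseq L l ++ nseq S (1 / K%:R), forall x : R, x \notin Im}.
  move=> x; rewrite mem_cat => /orP[/nseqP[-> _]|/nseqP[-> _]] //.
  by apply/negP => /ImP/andP[_]; rewrite leNgt l_gt.
have szw : size w = (size s + (L + S))%N by rewrite !size_cat !size_nseq.
have wi : is_input w.
  apply/allP => x; rewrite !mem_cat => /or3P[/sI/ImP|/nseqP[-> _]|/nseqP[-> _]].
  - by lra.
  - by lra.
  - by rewrite divr_gt0 //= ler_pdivrMr // mul1r ler1n.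
have wl i : i \in iota (size s) L -> (i < size w)%N /\ w`_i = l.
  rewrite mem_iota szw => /andP[si iL].
  split; first by apply: leq_trans iL _; rewrite addnA leq_addr.
  rewrite /w nth_cat ltnNge si /= nth_cat size_nseq ltn_subLR // iL.
  by rewrite nth_nseq ltn_subLR // iL.
have ws i : i \in iota (size s + L) S -> (i < size w)%N /\ w`_i = 1 / K%:R.
  rewrite mem_iota szw => /andP[sLi iS]; split; first by rewrite addnA.
  have si : (size s <= i)%N by apply: leq_trans (leq_addr _ _) sLi.
  rewrite /w nth_cat ltnNge si /= nth_cat size_nseq ltnNge leq_subRL // sLi /=.
  by rewrite nth_nseq -subnDA ltn_subLR // iS.
have B_in b : b \in B -> exists i, [/\ (i < size s)%N, s`_i \in Im,
    b = bin (pos s i) & nb_items_in_bin A Im s b = 3].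
  by move=> /B3/mem_bins_with.
have := cost_ge (K := K) (s := w) (Js := iota (size s + L) S)
  (Jl := iota (size s) L) (B := B ++ bins_with 4 s) sep wi.
rewrite !iota_uniq !size_iota size_cat; apply=> //.
- rewrite cat_uniq uB undup_uniq andbT /=; apply/hasPn => b.
  move=> /mem_bins_with[_ [_ _ _ b4]]; apply/negP => /B_in[_ [_ _ _]].
  by rewrite b4.
- move=> i /ws[iz ->]; split=> //.
  by rewrite ltr_pM2l // ltf_pV2 ?posrE ?ltr0n // ltr_nat.
- by move=> i /wl[iz ->].
- move=> b; rewrite mem_cat => bB.
  have [i [iz iI ->]] : exists i, [/\ (i < size s)%N, s`_i \in Im & b = bin (pos s i)].
    case/orP: bB => [/B_in[i [iz iI bi _]]|/mem_bins_with[i [iz iI bi _]]];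
    by exists i.
  exists i; rewrite online_packing_catl // /w nth_cat iz; split=> //.
  by rewrite szw ltn_addr.
- move=> j jl; have [jz jw] := wl j jl.
  rewrite mem_cat negb_or -(bins_with_catl 4 s uI) large_item_notin_bins_with4 //;
    last by rewrite jw.
  rewrite andbT; apply/negP => /BP[i [iz il bij]].
  have iw : (i < size w)%N by rewrite szw ltn_addr.
  have ij : i <> j by move=> ij; move: jl; rewrite mem_iota -ij leqNgt iz.
  have wp m : (m < size w)%N -> 0 < w`_m.
    by move=> mw; have /allP/(_ _ (mem_nth 0 mw))/andP[] := wi.
  have := two_items_in_bin_le1 (place_feasible A wi) iw jz ij (wp _ iw) (wp _ jz).
  rewrite online_packing_catl // bij => /(_ erefl).
  by rewrite jw /w nth_cat iz leNgt il.
Qed.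

End Algorithm.

(** The limit superior is an infimum of suprema over tails, and each tail contains the optimum of
    some bad input. *)
Lemma competitive_ratio_ge (A : online_algorithm R) (c : R) :
  (forall M : nat, exists s m,
     [/\ is_input s, is_OPT s m, (M <= m)%N & c * m%:R <= (cost A s)%:R]) ->
  (c%:E <= competitive_ratio A)%E.
Proof.
move=> H; rewrite /competitive_ratio /limn_esup /limf_esup.
apply: le_ereal_inf_tmp => _ [V [M _ MV] <-].
(* The successor keeps the optimum [m] nonzero, for the division. *)
have [s [m [si sm Mm cm]]] := H M.+1.
have m0 : (0 : R) < m%:R by rewrite ltr0n; apply: leq_trans Mm.
apply: (@le_trans _ _ ((cost A s)%:R / m%:R)%:E).
  by rewrite lee_fin ler_pdivlMr.
apply: (@le_trans _ _ (ereal_sup [set ((cost A s)%:R / m%:R)%:E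
              | s in [set s | is_input s /\ is_OPT s m]])).
  by apply: ereal_sup_ubound; exists s.
by apply: ereal_sup_ubound; exists m => //; apply: MV => /=; apply: ltnW.
Qed.

Lemma count_two_values (P : pred R) (a y : R) s : y != a ->
  {in s, forall x, x = a \/ x = y} ->
  count P s = (count_mem a s * P a + count_mem y s * P y)%N.
Proof.
move=> ya; elim: s => //= x s IH sP.
rewrite {}IH; last by move=> z zs; apply: sP; rewrite inE zs orbT.
have [->|->] := sP x (mem_head _ _); rewrite eqxx ?(negbTE ya) ?(eq_sym a) ?(negbTE ya).
all: by case: (P a); case: (P y); lia.
Qed.

(** [nA] bins hold a large and three small medium items, [nB] bins hold four items of side [y], and
    sand fills the cells left over. Medium items missing from the last bins are added first and then
    dropped. *)
Lemma packable_input (K p q r nA nB : nat) (y : R) s :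
  let a := p%:R / K%:R in let l := q%:R / K%:R in let d := 1 / K%:R in
  (0 < p)%N -> (p + q <= K)%N -> (2 * p <= K)%N -> (2 * r <= K)%N ->
  y <= r%:R / K%:R -> y != a -> {in s, forall x, x = a \/ x = y} ->
  (count_mem a s <= 3 * nA)%N -> (count_mem y s <= 4 * nB)%N ->
  packable (s ++ nseq nA l ++ nseq (nA * (K * K - (q * q + 3 * (p * p))) +
                                    nB * (K * K - 4 * (r * r))) d) (nA + nB).
Proof.
move=> a l d p0 pqK pK rK yr ya sP sa sy.
have K0 : (0 < K)%N by lia.
have pA := packable_flatten_nseq nA (packable_large_and_three p0 pqK pK).
have pB := packable_flatten_nseq nB (packable_four K0 rK yr).
apply: (packable_catl (t := nseq (3 * nA - count_mem a s) a ++
                            nseq (4 * nB - count_mem y s) y)).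
apply: packable_perm (packable_cat pA pB).
rewrite -/a -/l -/d; apply/permP => P.
rewrite !count_cat !count_flatten !map_nseq !sumn_nseq /= !count_nseq.
rewrite (count_two_values P ya sP).
set SA := (K * K - _)%N; set SB := (K * K - _)%N.
move: sa sy; set ca := count_mem a s; set cy := count_mem y s.
by case: (P a); case: (P y); case: (P l); case: (P d) => /=; nia.
Qed.

End Packing.

(** * The adversary *)

Section LowerBound.
Set Implicit Arguments.
Unset Strict Implicit.
Unset Printing Implicit Defensive.
Import Order.TTheory GRing.Theory Num.Theory.

Variable R : realType.

Let c : R := 2 + 43 / 10 ^+ 4.

(** Common to both cases: [B] will be empty or contain all red bins. A bin of the first kind in the
    offline packing costs the algorithm 1 for its large item plus the area of its sand; a bin of the
    second kind costs the area of its sand. *)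
Lemma adversary_input (A : online_algorithm R) (Im Il : interval R)
    (K p q r nA nB : nat) (y : R) (s : seq R) (B : seq nat) :
  let a : R := p%:R / K%:R in
  separation_rule A Im Il -> {in Im, forall x : R, 1 / 3 < x <= 1 / 2} ->
  1 / K%:R \in Il -> 1 / K%:R \notin Im -> a \in Im -> y \in Im -> y != a ->
  (0 < p)%N -> (p + q <= K)%N -> (2 * p <= K)%N -> (K < 2 * q)%N ->
  (2 * r <= K)%N -> y <= r%:R / K%:R ->
  {in s, forall x, x = a \/ x = y} ->
  (count_mem a s <= 3 * nA)%N -> (count_mem y s <= 4 * nB)%N ->
  uniq B -> {subset B <= bins_with A Im 3 s} ->
  (forall b, b \in B -> exists i, [/\ (i < size s)%N, 1 < s`_i + q%:R / K%:R &
                                      bin (online_packing A s i) = b]) ->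
  exists w m, [/\ is_input w, is_OPT w m, (nA <= m <= nA + nB)%N,
    nb_items_in Im w = size s /\ (forall k, nb_packed_per_bin A Im k w =
                                    k * size (bins_with A Im k s))%N &
    nA%:R * (2 - (q%:R / K%:R) ^+ 2 - 3 * a ^+ 2) +
    nB%:R * (1 - 4 * (r%:R / K%:R) ^+ 2) +
    (size B)%:R + (size (bins_with A Im 4 s))%:R <= (cost A w)%:R :> R].
Proof.
move=> a sep ImP dl dm aI yI ya p0 pqK pK Kq rK yr sP sa sy uB B3 BP.
have K0 : (0 < K)%N by lia.
have Kr : (0 : R) < K%:R by rewrite ltr0n.
have l2 : 1 / 2 < (q%:R / K%:R : R) <= 1.
  have : K%:R < 2 * q%:R :> R by rewrite -natrM ltr_nat.
  have : q%:R <= K%:R :> R by rewrite ler_nat; lia.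
  by move=> *; rewrite ltr_pdivlMr // ler_pdivrMr //; lra.
have sI : {in s, forall x, x \in Im} by move=> x /sP[->|->].
set S := (nA * (K * K - (q * q + 3 * (p * p))) + nB * (K * K - 4 * (r * r)))%N.
pose u : seq R := nseq nA (q%:R / K%:R) ++ nseq S (1 / K%:R).
have uI : {in u, forall x : R, x \notin Im}.
  move=> x; rewrite mem_cat => /orP[/nseqP[-> _]|/nseqP[-> _]] //.
  by apply/negP => /ImP; lra.
have pack := packable_input p0 pqK pK rK yr ya sP sa sy.
have [m om mle] := packable_is_OPT pack.
have costw := input_cost_ge nA S sep K0 ImP dl dm l2 sI uB B3 BP.
have wi : is_input (s ++ u).
  apply/allP => x; rewrite !mem_cat => /or3P[/sI/ImP|/nseqP[-> _]|/nseqP[-> _]].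
  - by lra.
  - by lra.
  - by rewrite divr_gt0 //= ler_pdivrMr // mul1r ler1n.
exists (s ++ u), m; split=> //.
(* The [nA] large items need distinct bins in any packing. *)
- rewrite mle andbT; have [[P [fP <-]] _] := om.
  have uJ := iota_uniq (size s) nA.
  have JP i : i \in iota (size s) nA ->
      (i < size (s ++ u))%N /\ 1 / 2 < (s ++ u)`_i.
    rewrite mem_iota => /andP[si iA]; rewrite !size_cat !size_nseq.
    split; first by apply: leq_trans iA _; rewrite addnA leq_addr.
    rewrite nth_cat ltnNge si /= nth_cat size_nseq ltn_subLR // iA.
    by rewrite nth_nseq ltn_subLR // iA (andP l2).1.
  have := bins_of_items_ge (k := 1) fP uJ JP.
  rewrite size_iota !mul1n => /leq_trans; apply.
  apply: uniq_leq_size; first exact: undup_uniq.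
  move=> b; rewrite !mem_undup => /mapP[i /JP[iz _] ->].
  by apply: map_f; rewrite mem_iota.
- split=> [|k]; last by rewrite nb_packed_per_binE bins_with_catl.
  rewrite /nb_items_in count_cat (@eq_in_count _ _ predT) ?count_predT; last first.
    by move=> x /sI.
  rewrite (@eq_in_count _ _ pred0) ?count_pred0 ?addn0 //.
  by move=> x /uI /negbTE.
(* Truncated subtraction only increases the difference. *)
have le_sub (i j : nat) : i%:R - j%:R <= (i - j)%:R :> R.
  by rewrite lerBlDr -natrD ler_nat; lia.
have KK : (0 : R) < K%:R * K%:R by rewrite mulr_gt0.
rewrite -(ler_pM2l KK); move: costw; rewrite -(ler_nat R) /S !(natrD, natrM).
set X := (size _)%:R; set Y := (size _)%:R; set C := (cost _ _)%:R.
have := le_sub (K * K)%N (q * q + 3 * (p * p))%N.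
have := le_sub (K * K)%N (4 * (r * r))%N.
rewrite !(natrD, natrM) => lB lA H; apply: le_trans H.
have nA0 : 0 <= nA%:R :> R by [].
have nB0 : 0 <= nB%:R :> R by [].
have := ler_wpM2l nA0 lA; have := ler_wpM2l nB0 lB.
rewrite /a; set SA := (K * K - _)%:R; set SB := (K * K - _)%:R => eB eA.
have E (x : nat) : K%:R * K%:R * (x%:R / K%:R) ^+ 2 = x%:R * x%:R :> R.
  by field; rewrite gt_eqF.
have Eq := E q; have Ep := E p; have Er := E r.
set Q := (q%:R / K%:R) ^+ 2 in Eq *; set V := (p%:R / K%:R) ^+ 2 in Ep *.
set T := (r%:R / K%:R) ^+ 2 in Er *.
rewrite -Eq -Ep in eA; rewrite -Er in eB.
lra.
Qed.

(** * Numerical estimates *)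

(** In the limit the ratio is at least 17/12 + 3 (1 - alpha) / 4, about 2.00437 at alpha = 0.2164;
    the margin over [c] absorbs [e], [h] and the rounding. *)
Lemma ratio_few_red (N nA Bl alpha e h Q V C : R) :
  alpha <= 2164 / 10 ^+ 4 -> 0 < e <= 1 / 10 ^+ 7 -> 0 < h <= 1 / 10 ^+ 7 ->
  10 ^+ 8 <= N -> 0 <= nA -> 3 * nA <= N + 2 ->
  `|4 * Bl - (1 - alpha) * N| <= e * N ->
  Q = 1 / 2 + h -> V = 1 / 3 + h ->
  nA * (2 - Q ^+ 2 - 3 * V ^+ 2) + Bl <= C ->
  c * nA <= C.
Proof.
move=> al /andP[e0 e1] /andP[h0 h1] N8 nA0 nAN + -> -> HC.
rewrite ler_norml => /andP[Bl1 _]; apply: le_trans HC.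
have hh : h * h <= h * (1 / 10 ^+ 7) by rewrite ler_wpM2l // ltW.
have u1 : (1 / 2 + h) ^+ 2 + 3 * (1 / 3 + h) ^+ 2 <= 7 / 12 + 1 / 10 ^+ 6 by lra.
have := ler_wpM2l nA0 u1.
have N0 : 0 <= N by lra.
have eN : e * N <= 1 / 10 ^+ 7 * N by rewrite ler_wpM2r.
have aN : alpha * N <= 2164 / 10 ^+ 4 * N by rewrite ler_wpM2r.
rewrite /c; lra.
Qed.

(* The bound is bilinear in y and the fraction of red bins once the two squares
   are replaced by their chords over [1 / 3, 1 / 2]; it then suffices to check
   the corners of a rectangle. *)
Lemma ratio_many_red (N nA nB Rd Bl alpha e h y Q V T C : R) :
  2164 / 10 ^+ 4 <= alpha <= 1 -> 0 < e <= 1 / 10 ^+ 7 -> 0 < h <= 1 / 10 ^+ 7 ->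
  1 / 3 < y <= 1 / 2 ->
  10 ^+ 8 <= N -> 0 <= nA -> 3 * nA <= N - Rd + 2 -> 0 <= nB ->
  4 * nB <= Rd + 3 ->
  `|3 * Rd - alpha * N| <= e * N ->
  `|4 * Bl - (1 - alpha) * N| <= e * N ->
  0 <= Q <= 1 - y + h -> V = 1 / 3 + h -> 0 <= T <= y + h ->
  nA * (2 - Q ^+ 2 - 3 * V ^+ 2) + nB * (1 - 4 * T ^+ 2) + Rd + Bl <= C ->
  c * (nA + nB) <= C.
Proof.
move=> /andP[al al1] /andP[e0 e1] /andP[h0 h1] /andP[y1 y2] N8 nA0 nAN nB0 nBR.
rewrite !ler_norml => /andP[R1 R2] /andP[Bl1 _] /andP[Q0 Q1] -> /andP[T0 T1] HC.
apply: le_trans HC.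
have hh : h * h <= h * (1 / 10 ^+ 7) by rewrite ler_wpM2l // ltW.
have hy : h * y <= h * (1 / 2) by rewrite ler_wpM2l // ltW.
have hy0 : 0 <= h * y by rewrite mulr_ge0 //; lra.
(* The chord of the square function over [1/3, 1/2] has slope 5/6. *)
have yy : y ^+ 2 <= 1 / 9 + 5 / 6 * (y - 1 / 3) by nra.
have Q2 : Q ^+ 2 <= (1 - y + h) ^+ 2 by rewrite ler_sqr ?nnegrE //; lra.
have T2 : T ^+ 2 <= (y + h) ^+ 2 by rewrite ler_sqr ?nnegrE //; lra.
have u1 : Q ^+ 2 + 3 * (1 / 3 + h) ^+ 2 <=
    7 / 9 - 7 / 6 * (y - 1 / 3) + 1 / 10 ^+ 6 by lra.
have v1 : 4 * T ^+ 2 <= 4 / 9 + 10 / 3 * (y - 1 / 3) + 1 / 10 ^+ 6 by lra.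
have N0 : 0 <= N by lra.
have eN : e * N <= 1 / 10 ^+ 7 * N by rewrite ler_wpM2r.
have aN : 2164 / 10 ^+ 4 * N <= alpha * N by rewrite ler_wpM2r.
have aN1 : alpha * N <= N by rewrite -[leRHS]mul1r ler_wpM2r.
pose t := y - 1 / 3.
(* [U] and [W] bound what each bin of the first or second kind still needs to reach [c]; the red and
   blue bins must pay for it. *)
pose U := c - 2 + 7 / 9 - 7 / 6 * t + 1 / 10 ^+ 6.
pose W := c - 1 + 4 / 9 + 10 / 3 * t + 1 / 10 ^+ 6.
have t0 : 0 <= t by rewrite /t; lra.
have t6 : 0 <= 1 / 6 - t by rewrite /t; lra.
have U0 : 0 <= U by rewrite /U /c; lra.
have W0 : 0 <= W by rewrite /W /c; lra.
have hA : nA * (c - 2 + (Q ^+ 2 + 3 * (1 / 3 + h) ^+ 2)) <= (N - Rd + 2) / 3 * U.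
  apply: (@le_trans _ _ (nA * U)).
    by apply: ler_wpM2l => //; rewrite /U /t; lra.
  by apply: ler_wpM2r => //; lra.
have hB : nB * (c - 1 + 4 * T ^+ 2) <= (Rd + 3) / 4 * W.
  apply: (@le_trans _ _ (nB * W)).
    by apply: ler_wpM2l => //; rewrite /W /t; lra.
  by apply: ler_wpM2r => //; lra.
suff : (N - Rd + 2) / 3 * U + (Rd + 3) / 4 * W <= Rd + Bl by lra.
(* The constant 0.072133 is just below 0.2164 / 3. *)
have r0 : 0 <= Rd - (72 + 133 / 10 ^+ 3) / 10 ^+ 3 * N by lra.
have r1 : 0 <= (1 / 3 + 1 / 10 ^+ 6) * N - Rd by lra.
(* The four products of nonnegative slacks are the corner certificates for a bilinear inequality in
   [t] and [Rd]. *)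
have p1 := mulr_ge0 t0 r0; have p2 := mulr_ge0 t0 r1.
have p3 := mulr_ge0 t6 r0; have p4 := mulr_ge0 t6 r1.
(* Adding the two fraction estimates cancels [alpha]. *)
have BlR : (1 - 2 / 10 ^+ 7) * N <= 4 * Bl + 3 * Rd by lra.
rewrite /U /W /c; clearbody t.
lra.
Qed.

(** * Choice of the parameters *)

(** With 6 dividing the number of cells per side, 1/3 and 1/2 are grid coordinates. The cells must
    be small enough to serve as sand, to leave a grid point between 1/3 and [y], and to make the
    errors negligible. *)
Lemma exists_grid (y lambda : R) : 1 / 3 < y <= 1 / 2 -> 0 < lambda ->
  exists k : nat, [/\ (1 < k)%N, 1 / (6 * k)%:R <= lambda,
    1 / 3 + 1 / (6 * k)%:R < y & 0 < (1 / (6 * k)%:R : R) <= 1 / 10 ^+ 7].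
Proof.
move=> /andP[y1 y2] l0.
have dy : 0 < y - 1 / 3 by lra.
pose X := lambda^-1 + (y - 1 / 3)^-1 + 10 ^+ 7.
have l1 : 0 < lambda^-1 by rewrite invr_gt0.
have d1 : 0 < (y - 1 / 3)^-1 by rewrite invr_gt0.
have X0 : 0 <= X by rewrite /X; lra.
have Xk := archi_boundP X0; set k := Num.bound X in Xk.
have k0 : (0 : R) < k%:R by apply: le_lt_trans Xk.
have K0 : 0 < (6 * k)%:R :> R by rewrite natrM mulr_gt0.
have XK : X < (6 * k)%:R by rewrite natrM; lra.
exists k; split.
- by rewrite -(ltr_nat R); rewrite /X in Xk; lra.
- rewrite div1r invf_ple ?posrE //; rewrite /X in XK; lra.
- suff : 1 / (6 * k)%:R < y - 1 / 3 by lra.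
  rewrite div1r invf_plt ?posrE //; rewrite /X in XK; lra.
- rewrite divr_gt0 //= !div1r lef_pV2 ?posrE ?exprn_gt0 //.
  rewrite /X in XK; lra.
Qed.

Lemma exists_bad_input (A : online_algorithm R) : class_B1 A ->
  forall M : nat, exists s m,
    [/\ is_input s, is_OPT s m, (M <= m)%N & c * m%:R <= (cost A s)%:R].
Proof.
move=> [y [lambda [alpha [[y12 l0 dis al01] [rb sep ob]]]]] M.
have /andP[al0 al1] := al01; have /andP[y1 y2] := y12.
set Im := (X in red_blue_rule A X _) in rb sep ob dis.
set Il := (X in separation_rule A _ X) in sep dis.
have [k [k1 kl ky kh]] := exists_grid y12 l0; have k0 := ltnW k1.
have /andP[h0 h1] := kh.
set K := (6 * k)%N in kl ky kh h0 h1 *; set h : R := 1 / K%:R in kl ky kh h0 h1 *.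
have Kr : (0 : R) < K%:R by rewrite ltr0n /K; move: k0; clear; lia.
have hK : K%:R * h = 1 by rewrite /h mulrC divfK // gt_eqF.
have ImP : {in Im, forall x : R, 1 / 3 < x <= 1 / 2}.
  by move=> x; rewrite in_itv /= => /andP[x1 x2]; rewrite x1 (le_trans x2).
have Im01 : {in Im, forall x : R, 0 < x <= 1} by move=> x /ImP; lra.
(* [a] is the least multiple of 1 / K above 1/3. *)
pose p := (2 * k + 1)%N; pose a : R := p%:R / K%:R.
have aE : a = 1 / 3 + h.
  rewrite /a /p /h natrD mulrDl /K !natrM; congr (_ + _).
  by field; rewrite pnatr_eq0 -lt0n k0.
have dIl : 1 / K%:R \in Il by rewrite in_itv /= h0.
have dIm : 1 / K%:R \notin Im.
  apply/negP => /ImP; rewrite -/h; lra.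
have aI : a \in Im by rewrite in_itv /= aE; apply/andP; split; lra.
have yI : y \in Im by rewrite in_itv /= y1 lexx.
have ya : y != a by rewrite aE gt_eqF.
have [p0 pK] : (0 < p)%N /\ (2 * p <= K)%N by rewrite /p /K; move: k1; clear; lia.
have half : y <= (3 * k)%:R / K%:R.
  rewrite [_ / _](_ : _ = 1 / 2) //.
  by rewrite /K !natrM; field; rewrite pnatr_eq0 -lt0n k0.
pose e : R := 1 / 10 ^+ 7.
have e0 : 0 < e <= 1 / 10 ^+ 7 by rewrite /e lexx andbT divr_gt0 // exprn_gt0.
have [N0 N0P] := rb e (andP e0).1.
(* [N0] activates the red-blue rule, [6 * M] makes the optimum large, and 10 ^ 8 makes the rounding
   negligible. *)
have [N [NN0 NM N8]] : exists N : nat,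
    [/\ (N0 <= N)%N, (6 * M <= N)%N & 10 ^+ 8 <= N%:R :> R].
  exists (N0 + 6 * M + Num.bound (10 ^+ 8 : R))%N.
  split; [by rewrite -addnA leq_addr|by rewrite addnAC leq_addl|].
  have X0 : (0 : R) <= 10 ^+ 8 by rewrite exprn_ge0.
  apply: le_trans (ltW (archi_boundP X0)) _; rewrite ler_nat; exact: leq_addl.
have [al|al] := leP alpha (2164 / 10 ^+ 4).
- pose s := nseq N a; pose nA := ((N + 2) %/ 3)%N.
  (* Large items get the least multiple of 1 / K above 1/2; no medium item has side [y], so [nB] is
     0, and [B] is empty. *)
  pose q := (3 * k + 1)%N; pose r := (3 * k)%N.
  have qE : q%:R / K%:R = 1 / 2 + h :> R.
    rewrite /q /h natrD mulrDl /K !natrM; congr (_ + _).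
    by field; rewrite pnatr_eq0 -lt0n k0.
  have sP : {in s, forall x, x = a \/ x = y} by move=> x /nseqP[->]; left.
  (* Here [p + q] is [5 * k + 2], which is at most [6 * k] because [k > 1]. *)
  have [pqK Kq rK] : [/\ (p + q <= K)%N, (K < 2 * q)%N & (2 * r <= K)%N].
    by rewrite /p /q /r /K; move: k1; clear=> k1; split; lia.
  have sa : (count_mem a s <= 3 * nA)%N.
    by rewrite count_nseq /= eqxx mul1n /nA; clear; lia.
  have sy : (count_mem y s <= 4 * 0)%N.
    by rewrite count_nseq /= eq_sym (negbTE ya).
  have [|//|w [m [wi om /andP[m1 m2] [wN wk] wc]]] :=
    adversary_input (B := [::]) sep ImP dIl dIm aI yI ya p0 pqK pK Kq rK half
      sP sa sy isT.
    by [].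
  exists w, m; split=> //.
    by rewrite (leq_trans _ m1) // /nA; move: NM; clear; lia.
  have := N0P w wi; rewrite wN size_nseq => /(_ NN0)[_].
  rewrite wk natrM => w4.
  have nA0 : 0 <= nA%:R :> R by [].
  have nAN : 3 * nA%:R <= N%:R + 2 :> R.
    by rewrite -natrM -(natrD _ _ 2) ler_nat /nA; clear; lia.
  have mA : m%:R <= nA%:R :> R by rewrite ler_nat -[nA]addn0.
  apply: (@le_trans _ _ (c * nA%:R)).
    by apply: ler_wpM2l => //; rewrite /c; lra.
  apply: (ratio_few_red al e0 kh N8 nA0 nAN w4 qE aE).
  by apply: le_trans wc; rewrite mul0r !addr0.
(* Case of many red bins: [r] is [K * y] rounded up. *)
have exr : exists r : nat, K%:R * y <= r%:R.
  exists K; rewrite -[leRHS]mulr1; apply: ler_wpM2l; [exact: ltW|lra].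
have [r rP rmin] := ex_minnP exr.
have r3 : (r <= 3 * k)%N.
  by apply: rmin; move: half; rewrite ler_pdivlMr // mulrC.
have yr : y <= r%:R / K%:R by rewrite ler_pdivlMr // mulrC.
have pr : (p < r)%N.
  rewrite -(ltr_nat R); apply: lt_le_trans rP.
  have -> : p%:R = K%:R * a by rewrite /a mulrC divfK // gt_eqF.
  by rewrite ltr_pM2l // aE.
have rT : r%:R / K%:R < y + h.
  rewrite ltr_pdivrMr // mulrC mulrDr hK -ltrBlDr.
  have r1 : (r.-1 < r)%N by move: pr; clear; lia.
  have -> : r%:R - 1 = r.-1%:R :> R.
    by rewrite -[in LHS](ltn_predK r1) -natr1 addrK.
  by rewrite ltNge; apply/negP => /rmin; move: pr; clear; lia.
(* The extra cell makes a large item too big to lie next to one of side [y], since [r / K < y + h];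
   it still fits next to [p] cells, since [p < r]. *)
pose q := (K - r + 1)%N.
have rK' : (r <= K)%N by rewrite /K; move: r3; clear; lia.
have qE : q%:R / K%:R = 1 - r%:R / K%:R + h :> R.
  by rewrite /q /h natrD natrB // !mulrDl mulNr divff // gt_eqF.
have [pqK Kq rK] : [/\ (p + q <= K)%N, (K < 2 * q)%N & (2 * r <= K)%N].
  by move: pr r3 k0 rK'; rewrite /q /K; clear=> *; split; lia.
have [s [szs sP s3 sB]] := mark_red_bins N ob Im01 yI aI ya.
set Rd := count_mem y s in s3.
have sN : (count_mem a s + Rd)%N = N.
  by rewrite -szs -(count_predT s) (count_two_values predT ya sP) !muln1.
pose nA := ((N - Rd + 2) %/ 3)%N; pose nB := ((Rd + 3) %/ 4)%N.
have sa : (count_mem a s <= 3 * nA)%N by rewrite /nA -sN addnK; clear; lia.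
have sy : (count_mem y s <= 4 * nB)%N by rewrite -/Rd /nB; clear; lia.
have BP b : b \in bins_with A Im 3 s -> exists i, [/\ (i < size s)%N,
    1 < s`_i + q%:R / K%:R & bin (online_packing A s i) = b].
  move=> /sB[i [iz iy ib]]; exists i; split=> //.
  by rewrite iy qE; lra.
have [w [m [wi om /andP[m1 m2] [wN wk] wc]]] :=
  adversary_input sep ImP dIl dIm aI yI ya p0 pqK pK Kq rK yr sP sa sy
    (undup_uniq _) (fun=> id) BP.
have := N0P w wi; rewrite wN szs => /(_ NN0)[].
rewrite !wk !natrM s3 => w3 w4.
have nA0 : 0 <= nA%:R :> R by [].
have nB0 : 0 <= nB%:R :> R by [].
have RdN : (Rd <= N)%N by rewrite -sN leq_addl.
have nAN : 3 * nA%:R <= N%:R - Rd%:R + 2 :> R.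
  by rewrite -natrB // -natrM -(natrD _ _ 2) ler_nat /nA; clear; lia.
have nAN' : N%:R - Rd%:R <= 3 * nA%:R :> R.
  by rewrite -natrB // -natrM ler_nat /nA; clear; lia.
have nBR : 4 * nB%:R <= Rd%:R + 3 :> R.
  by rewrite -natrM -(natrD _ _ 3) ler_nat /nB; clear; lia.
exists w, m; split=> //.
  apply: leq_trans m1; rewrite -(ler_nat R).
  (* Red bins hold three items each, so [Rd] is at most N / 2; hence [nA] is at least N / 6. *)
  have NM' : 6 * M%:R <= N%:R :> R by rewrite -natrM ler_nat.
  have Np : 0 <= N%:R :> R by [].
  have aN : alpha * N%:R <= N%:R by rewrite -[leRHS]mul1r ler_wpM2r.
  have eN : e * N%:R <= 1 / 2 * N%:R by rewrite ler_wpM2r //; lra.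
  by move: w3; rewrite ler_norml => /andP[_]; lra.
have mA : m%:R <= nA%:R + nB%:R :> R by rewrite -natrD ler_nat.
apply: (@le_trans _ _ (c * (nA%:R + nB%:R))).
  by apply: ler_wpM2l => //; rewrite /c; lra.
have al' : 2164 / 10 ^+ 4 <= alpha <= 1 by rewrite ltW.
have QP : 0 <= (q%:R / K%:R : R) <= 1 - y + h.
  by rewrite divr_ge0 //= qE; lra.
have TP : 0 <= (r%:R / K%:R : R) <= y + h by rewrite divr_ge0 //= ltW.
apply: (ratio_many_red al' e0 kh y12 N8 nA0 nAN nB0 nBR w3 w4 QP aE TP).
by rewrite -s3.
Qed.

End LowerBound.

(* 2 + 43 / 10 ^+ 4 is 2.0043 *)
Theorem theorem3 (R : realType) (A : online_algorithm R) (A_B1 : class_B1 A) :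
  ((2 + 43 / 10 ^+ 4 : R)%:E <= competitive_ratio A)%E.
Proof.
by apply: competitive_ratio_ge; apply: exists_bad_input.
Qed.
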